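(* Let $A$ be a real $m\times n$ matrix and $B$ a real $n\times\rho$ matrix, let $\Theta^{(\kappa)}=\{\Theta^{(\kappa)}_1,\ldots,\Theta^{(\kappa)}_k\}$ be a partition of $\{1,\ldots,n\}$ with $|\Theta^{(\kappa)}|=k$ and $A_{(,\Theta^{(\kappa)}_\ell)}B_{(\Theta^{(\kappa)}_\ell,)}\neq0$ for all $\ell$, and let $p^{(\kappa)}=(p^{(\kappa)}_\ell)_{\ell=1}^k$ be its optimal sampling probability $$p^{(\kappa)}_\ell=\frac{\|A_{(,\Theta^{(\kappa)}_\ell)}B_{(\Theta^{(\kappa)}_\ell,)}\|_F}{M},\qquad M:=\sum_{j=1}^k\big\|A_{(,\Theta^{(\kappa)}_j)}B_{(\Theta^{(\kappa)}_j,)}\big\|_F.$$ For a fixed integer $c\ge1$ let $$\hat S=\frac1c\sum_{i=1}^c\frac1{p^{(\kappa)}_{r_i}}A_{(,\Theta^{(\kappa)}_{r_i})}B_{(\Theta^{(\kappa)}_{r_i},)},$$ where $r_1,\ldots,r_c$ are independent samples from $\{1,\ldots,k\}$ drawn according to $p^{(\kappa)}$. Then for any $\epsilon>0$, $$\mathbb{P}_{p^{(\kappa)}}\big(\|\hat S-AB\|_2>\epsilon\big)\le(m+\rho)\exp\Big(-\frac{c\epsilon^2}{2(\|AB\|_2+M)^2+\epsilon(\|AB\|_2+M)}\Big).$$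
   Context: A partition of $\{1,\ldots,n\}$ is into nonempty disjoint blocks $\Theta^{(\kappa)}_\ell$ of indices. $A_{(,\Theta^{(\kappa)}_\ell)}$ is the matrix formed by the columns of $A$ with indices in $\Theta^{(\kappa)}_\ell$, and $B_{(\Theta^{(\kappa)}_\ell,)}$ is the matrix formed by the rows of $B$ with indices in $\Theta^{(\kappa)}_\ell$ (same ordering of indices). A sampling probability has all entries positive and summing to $1$. $\|\cdot\|_F$ is the Frobenius norm and $\|\cdot\|_2$ the spectral norm (operator norm induced by the Euclidean norm). $\mathbb{P}_{p^{(\kappa)}}$ denotes probability under $p^{(\kappa)}$. *)

(* Defs.v *)
From HB Require Import structures.
From mathcomp Require Import all_boot all_order all_algebra.
From mathcomp Require Import all_classical all_reals all_analysis.

Set Implicit Arguments.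
Unset Strict Implicit.
Unset Printing Implicit Defensive.

Import Order.TTheory GRing.Theory Num.Theory.
Import numFieldNormedType.Exports.

Local Open Scope classical_set_scope.
Local Open Scope ring_scope.

(* The norm `|A| that MathComp-Analysis puts on matrices is the max-entry norm,
   so the Frobenius, Euclidean and spectral norms are defined explicitly. *)
Definition frobenius_norm (R : realType) (m n : nat) (A : 'M[R]_(m, n)) : R :=
  Num.sqrt (\sum_i \sum_j A i j ^+ 2).

Definition euclidean_norm (R : realType) (n : nat) (x : 'cV[R]_n) : R :=
  Num.sqrt (\sum_i x i 0 ^+ 2).

(* The supremum is over the closed unit ball rather than the unit sphere so that
   it is over a nonempty set even when A has no column. *)
Definition spectral_norm (R : realType) (m n : nat) (A : 'M[R]_(m, n)) : R :=
  sup [set euclidean_norm (A *m x) |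
       x in [set x : 'cV[R]_n | euclidean_norm x <= 1]].

(* The partition {Theta_1, ..., Theta_k} into k distinct blocks, enumerated by
   Theta; nonemptiness of the blocks is part of finset.partition. *)
Definition enumerates_partition (n k : nat) (Theta : 'I_k -> {set 'I_n}) : Prop :=
  injective Theta /\
  finset.partition [set Theta l | l : 'I_k]%SET [set: 'I_n]%SET.

(* enum_val lists the elements of a set of ordinals in increasing order. *)
Definition cols_of (R : realType) (m n : nat) (A : 'M[R]_(m, n))
    (S : {set 'I_n}) : 'M[R]_(m, #|S|) :=
  colsub (fun j : 'I_#|S| => enum_val j) A.

Definition rows_of (R : realType) (n rho : nat) (B : 'M[R]_(n, rho))
    (S : {set 'I_n}) : 'M[R]_(#|S|, rho) :=
  rowsub (fun i : 'I_#|S| => enum_val i) B.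

Definition block_product (R : realType) (m n rho k : nat)
    (A : 'M[R]_(m, n)) (B : 'M[R]_(n, rho)) (Theta : 'I_k -> {set 'I_n})
    (l : 'I_k) : 'M[R]_(m, rho) :=
  cols_of A (Theta l) *m rows_of B (Theta l).

Definition total_mass (R : realType) (m n rho k : nat)
    (A : 'M[R]_(m, n)) (B : 'M[R]_(n, rho)) (Theta : 'I_k -> {set 'I_n}) : R :=
  \sum_(j < k) frobenius_norm (block_product A B Theta j).

Definition optimal_prob (R : realType) (m n rho k : nat)
    (A : 'M[R]_(m, n)) (B : 'M[R]_(n, rho)) (Theta : 'I_k -> {set 'I_n})
    (l : 'I_k) : R :=
  frobenius_norm (block_product A B Theta l) / total_mass A B Theta.

Definition sampled_product (R : realType) (m n rho k c : nat)
    (A : 'M[R]_(m, n)) (B : 'M[R]_(n, rho)) (Theta : 'I_k -> {set 'I_n})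
    (p : 'I_k -> R) (s : 'I_c -> 'I_k) : 'M[R]_(m, rho) :=
  c%:R^-1 *: \sum_(i < c) (p (s i))^-1 *: block_product A B Theta (s i).

(* 'I_k is not a measurableType in the library (it may be empty); it carries the
   discrete sigma-algebra here, so every subset of it is an event. *)
Definition discrete_random_variable (d : measure_display)
    (T : measurableType d) (k : nat) (X : T -> 'I_k) : Prop :=
  forall E : set 'I_k, measurable (X @^-1` E).

Definition mutually_independent (d : measure_display) (T : measurableType d)
    (R : realType) (P : probability T R) (k : nat) (I : finType)
    (X : I -> T -> 'I_k) : Prop :=
  forall (J : {set I}) (E : I -> set 'I_k),
    P (\bigcap_(i in [set` J]) (X i @^-1` E i)) =
    (\prod_(i in J) P (X i @^-1` E i))%E.

Definition iid_samples (d : measure_display) (T : measurableType d)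
    (R : realType) (P : probability T R) (k c : nat) (p : 'I_k -> R)
    (r : 'I_c -> T -> 'I_k) : Prop :=
  [/\ forall i, discrete_random_variable (r i),
      forall i l, P (r i @^-1` [set l]) = (p l)%:E &
      mutually_independent P r].

(* Main.v *)
Require Import Defs.
From HB Require Import structures.
From mathcomp Require Import all_boot all_order all_algebra.
From mathcomp Require Import all_classical all_reals all_analysis.
From mathcomp Require Import polyrcf ring lra zify.

Set Implicit Arguments.
Unset Strict Implicit.
Unset Printing Implicit Defensive.

Import Order.TTheory GRing.Theory Num.Theory.
Import numFieldNormedType.Exports.

Local Open Scope classical_set_scope.
Local Open Scope ring_scope.

(** Write p, Theta and M as in the theorem and K = |AB|_2 + M.  The deviation
    Shat - AB is the average of c independent copies of the random matrix
    X_l = A_l B_l / p_l - AB, which is centered because the A_l B_l sum to AB.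
    The choice of p gives every A_l B_l / p_l the Frobenius norm M, so the
    operator norm of X never exceeds K.  The result is therefore a Hoeffding
    inequality for random matrices, with exponent - c eps^2 / (2 K^2), which is
    below the exponent of the theorem.

    The usual proofs of such inequalities rest on trace inequalities for the
    matrix exponential (Golden-Thompson, Lieb).  Only even moments are used here,
    so that everything reduces to traces of powers of symmetric matrices.
    - The Hermitian dilation replaces an m x rho matrix by a symmetric matrix of
      size m + rho with the same operator norm.
    - For symmetric X, Y and even n, cyclicity and Cauchy-Schwarz make the even
      terms of i |-> tr (X Y^i X Y^{n-i}) a convex sequence with equal ends
      (trace_alternating_le), while an odd term is at most the mean of its two
      neighbours; so each term is at most tr (X^2 Y^n).
      Consequently f_q(t) = tr (Y + tX)^{2q} / (2q)! satisfies
      f_q'' <= |X|^2 f_{q-1}.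
    - After averaging over a centered X the first derivative vanishes at 0, and
      integrating twice (poly_second_order_comparison) shows that adding one
      independent summand multiplies the generating function of the even moments
      by at most cosh (K z), coefficientwise.  Dominating cosh (K z) by
      exp (K^2 z^2 / 2), whose powers are explicit, gives the moments of a Gaussian
      (even_moment_sum_le).
    - If |Z| > eps, then tr (dilation Z)^{2q} >= 2 eps^{2q}
      (dilation_even_power_ge).  Markov's inequality for every q, summed against
      the coefficients of cosh, yields P cosh x <= (m + rho) exp (x / 2) / 2 with
      x = c eps^2 / K^2, and cosh x >= exp x / 2 concludes.  The factor 2
      coming from the dilation compensates the one lost in this last step. *)

(** * Frobenius inner product and operator norm bounds *)

Section FrobeniusInnerProduct.
Variable R : rcfType.

Definition frobenius_dot m n (A B : 'M[R]_(m, n)) : R := \tr (A^T *m B).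

Local Notation "'[ A , B ]" := (frobenius_dot A B).
Local Notation "'[ A ]" := (frobenius_dot A A).

Lemma frobenius_dotE m n (A B : 'M[R]_(m, n)) :
  '[A, B] = \sum_i \sum_j A i j * B i j.
Proof.
rewrite exchange_big; apply: eq_bigr => j _ /=.
by rewrite mxE; apply: eq_bigr => i _; rewrite mxE.
Qed.

Lemma frobenius_dotC m n (A B : 'M[R]_(m, n)) : '[A, B] = '[B, A].
Proof. by rewrite /frobenius_dot -mxtrace_tr trmx_mul trmxK. Qed.

Lemma frobenius_dotDr m n (A B C : 'M[R]_(m, n)) :
  '[A, B + C] = '[A, B] + '[A, C].
Proof. by rewrite /frobenius_dot mulmxDr mxtraceD. Qed.

Lemma frobenius_dotZr m n a (A B : 'M[R]_(m, n)) : '[A, a *: B] = a * '[A, B].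
Proof. by rewrite /frobenius_dot -scalemxAr mxtraceZ. Qed.

Lemma frobenius_sq_ge0 m n (A : 'M[R]_(m, n)) : 0 <= '[A].
Proof.
by rewrite frobenius_dotE; do 2!(apply: sumr_ge0 => ? _); exact: sqr_ge0.
Qed.

Lemma frobenius_sq_eq0 m n (A : 'M[R]_(m, n)) : ('[A] == 0) = (A == 0).
Proof.
apply/eqP/eqP => [|->]; last by rewrite /frobenius_dot mulmx0 mxtrace0.
rewrite frobenius_dotE => /psumr_eq0P H; apply/matrixP => i j; rewrite mxE.
have /psumr_eq0P Hi : \sum_j A i j * A i j = 0.
  by apply: H => // k _; apply: sumr_ge0 => l _; exact: sqr_ge0.
by have /eqP := Hi (fun l _ => sqr_ge0 _) j isT; rewrite mulf_eq0 orbb => /eqP.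
Qed.

Lemma frobenius_sqD m n (A B : 'M[R]_(m, n)) :
  '[A + B] = '[A] + 2 * '[A, B] + '[B].
Proof.
rewrite frobenius_dotDr !(frobenius_dotC (A + B)) !frobenius_dotDr.
by rewrite (frobenius_dotC B A); ring.
Qed.

Lemma frobenius_sqZ m n a (A : 'M[R]_(m, n)) : '[a *: A] = a ^+ 2 * '[A].
Proof. by rewrite frobenius_dotZr frobenius_dotC frobenius_dotZr; ring. Qed.

Lemma frobenius_dot_AMGM m n (A B : 'M[R]_(m, n)) : 2 * '[A, B] <= '[A] + '[B].
Proof.
have := frobenius_sq_ge0 (A + (-1) *: B).
by rewrite frobenius_sqD frobenius_dotZr frobenius_sqZ; lra.
Qed.

Lemma frobenius_CauchySchwarz m n (A B : 'M[R]_(m, n)) :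
  '[A, B] ^+ 2 <= '[A] * '[B].
Proof.
have [/eqP B0|B0] := boolP ('[B] == 0).
  have/eqP -> : B == 0 by rewrite -frobenius_sq_eq0 B0.
  by rewrite /frobenius_dot !mulmx0 mxtrace0 expr0n mulr0.
have Bgt0 : 0 < '[B] by rewrite lt_neqAle eq_sym B0 frobenius_sq_ge0.
have := frobenius_sq_ge0 ('[B] *: A + (- '[A, B]) *: B).
rewrite frobenius_sqD !frobenius_sqZ frobenius_dotZr (frobenius_dotC (_ *: A)).
rewrite frobenius_dotZr (frobenius_dotC B A).
rewrite [leRHS](_ : _ = '[B] * ('[A] * '[B] - '[A, B] ^+ 2)); last by ring.
by rewrite pmulr_rge0 // subr_ge0.
Qed.

Lemma frobenius_sq_triangle m n (A B : 'M[R]_(m, n)) a b :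
  0 <= a -> 0 <= b -> '[A] <= a ^+ 2 -> '[B] <= b ^+ 2 ->
  '[A + B] <= (a + b) ^+ 2.
Proof.
move=> a0 b0 Aa Bb.
have AB : '[A, B] <= a * b.
  rewrite (le_trans (ler_norm _))// -ler_sqr ?nnegrE ?mulr_ge0//.
  rewrite real_normK ?num_real//.
  rewrite (le_trans (frobenius_CauchySchwarz A B))// exprMn.
  by apply: ler_pM => //; exact: frobenius_sq_ge0.
by rewrite frobenius_sqD; nra.
Qed.

Lemma frobenius_sq_cols m n (A : 'M[R]_(m, n)) : '[A] = \sum_j '[col j A].
Proof.
rewrite frobenius_dotE exchange_big; apply: eq_bigr => j _ /=.
rewrite frobenius_dotE; apply: eq_bigr => i _.
by rewrite big_ord1 mxE.
Qed.

Lemma frobenius_sq_rows m n (A : 'M[R]_(m, n)) : '[A] = \sum_i '[(row i A)^T].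
Proof.
rewrite frobenius_dotE; apply: eq_bigr => i _ /=.
rewrite frobenius_dotE; apply: eq_bigr => j _.
by rewrite big_ord1 !mxE.
Qed.

Lemma frobenius_dot_col_mx m1 m2 n (A1 B1 : 'M[R]_(m1, n))
    (A2 B2 : 'M[R]_(m2, n)) :
  '[col_mx A1 A2, col_mx B1 B2] = '[A1, B1] + '[A2, B2].
Proof. by rewrite /frobenius_dot tr_col_mx mul_row_col mxtraceD. Qed.

Lemma frobenius_dot_row_mx m n1 n2 (A1 B1 : 'M[R]_(m, n1))
    (A2 B2 : 'M[R]_(m, n2)) :
  '[row_mx A1 A2, row_mx B1 B2] = '[A1, B1] + '[A2, B2].
Proof. by rewrite /frobenius_dot tr_row_mx mul_col_row mxtrace_block. Qed.

(** Consequence of Cauchy-Schwarz applied to each row: the operator norm is at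
    most the Frobenius norm. *)
Lemma frobenius_sq_mul_le m n (A : 'M[R]_(m, n)) (x : 'cV[R]_n) :
  '[A *m x] <= '[A] * '[x].
Proof.
rewrite frobenius_dotE (frobenius_sq_rows A) mulr_suml.
apply: ler_sum => i _; rewrite big_ord1 -expr2.
suff -> : (A *m x) i 0 = '[(row i A)^T, x] by exact: frobenius_CauchySchwarz.
by rewrite /frobenius_dot trmxK -row_mul /mxtrace big_ord1 [RHS]mxE.
Qed.

(** The operator norm bound in squared form, which avoids square roots and
    extends to matrices in place of x (op_le_mulmx). *)
Definition op_le m n (A : 'M[R]_(m, n)) (L : R) :=
  forall x : 'cV[R]_n, '[A *m x] <= L ^+ 2 * '[x].

Lemma op_le_mulmx m n p (A : 'M[R]_(m, n)) L (W : 'M[R]_(n, p)) :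
  op_le A L -> '[A *m W] <= L ^+ 2 * '[W].
Proof.
move=> AL; rewrite !frobenius_sq_cols mulr_sumr; apply: ler_sum => j _.
by rewrite !colE -mulmxA; exact: AL.
Qed.

(** |A^T y|^2 = <y, A A^T y> <= |y| L |A^T y|. *)
Lemma op_le_tr m n (A : 'M[R]_(m, n)) L : op_le A L -> op_le A^T L.
Proof.
move=> AL y.
have := frobenius_CauchySchwarz y (A *m (A^T *m y)).
rewrite {1}/frobenius_dot [y^T *m _]mulmxA -{1}[A]trmxK -trmx_mul.
rewrite -/(frobenius_dot _ _).
have := AL (A^T *m y); have := frobenius_sq_ge0 y.
have := frobenius_sq_ge0 (A^T *m y); have := frobenius_sq_ge0 (A *m (A^T *m y)).
move: ('[A^T *m y]) ('[A *m _]) ('[y]) => u v w v0 u0 w0 vu uu.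
have [->|un0] := eqVneq u 0; first by rewrite mulr_ge0 ?sqr_ge0.
have ugt0 : 0 < u by rewrite lt_neqAle eq_sym un0.
rewrite -(ler_pM2l ugt0) -expr2 (le_trans uu)// [leRHS](_ : _ = w * (L ^+ 2 * u)).
  exact: ler_wpM2l.
by ring.
Qed.

Lemma op_leD m n (A B : 'M[R]_(m, n)) a b : 0 <= a -> 0 <= b ->
  op_le A a -> op_le B b -> op_le (A + B) (a + b).
Proof.
move=> a0 b0 Aa Bb x.
rewrite -(sqr_sqrtr (frobenius_sq_ge0 x)) -exprMn mulrDl mulmxDl.
apply: frobenius_sq_triangle; rewrite ?mulr_ge0 ?sqrtr_ge0//;
  by rewrite exprMn sqr_sqrtr ?frobenius_sq_ge0.
Qed.
End FrobeniusInnerProduct.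

(** * Traces of alternating products of symmetric matrices *)

Local Notation "'[ A , B ]" := (frobenius_dot A B).
Local Notation "'[ A ]" := (frobenius_dot A A).

Lemma trmxX (R : comPzRingType) d (A : 'M[R]_d) i : (A ^+ i)^T = A^T ^+ i.
Proof.
elim: i => [|i IH]; first by rewrite !expr0 trmx1.
by rewrite exprS exprSr -!mulmxE trmx_mul IH.
Qed.

(** The inequality (i + 1) e_i <= e_0 + i e_{i+1} propagates upwards through
    convexity; read downwards from e_h <= e_0 it gives the claim. *)
Lemma convex_seq_le (R : realFieldType) (e : nat -> R) h :
  (forall i, (i.+2 <= h)%N -> 2 * e i.+1 <= e i + e i.+2) ->
  e h <= e 0%N -> forall i, (i <= h)%N -> e i <= e 0%N.
Proof.
move=> convex eh.
have up i : (i < h)%N -> i.+1%:R * e i <= e 0%N + i%:R * e i.+1.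
  elim: i => [|i IH] ih; first by rewrite mul1r mul0r addr0.
  have := IH (ltnW ih); have := convex _ ih; rewrite -!natr1.
  have : 0 <= i%:R :> R by exact: ler0n.
  by move: (i%:R) (e i) (e i.+1) (e i.+2) (e 0%N) => *; nra.
move=> i ih; rewrite -(subKn ih); elim: (h - i)%N => [|j IH]; first by rewrite subn0.
have [hj|jh] := leqP h j.
  by rewrite (_ : h - j.+1 = 0)%N //; apply/eqP; rewrite subn_eq0 leqW.
have hj : (h - j = (h - j.+1).+1)%N by lia.
have := up (h - j.+1)%N; rewrite hj in IH; rewrite -hj leq_subr hj => /(_ isT).
move: (h - j.+1)%N IH => l IH.
rewrite -[l.+1%:R]natr1 => H.
have : 0 <= l%:R :> R by exact: ler0n.
move=> l0; have : l%:R * e l.+1 <= l%:R * e 0%N by exact: ler_wpM2l.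
move=> H'; rewrite -(@ler_pM2l _ (l%:R + 1)) ?ltr_wpDl//.
by rewrite (le_trans H)// mulrDl mul1r addrC lerD2r.
Qed.

Section TraceInequality.
Variables (R : rcfType) (d : nat) (X Y : 'M[R]_d).
Hypotheses (Xsym : X^T = X) (Ysym : Y^T = Y).

Let U h i := Y ^+ i * X * Y ^+ (h - i).

Let dotU h i j : (i <= h)%N -> (j <= h)%N ->
  '[U h i, U h j] = \tr (X * Y ^+ (i + j) * X * Y ^+ (h.*2 - (i + j))).
Proof.
move=> ih jh; rewrite /frobenius_dot /U -!mulmxE !trmx_mul !trmxX Xsym Ysym.
rewrite !mulmxA mxtrace_mulC !mulmxA !mulmxE -exprD.
rewrite -(mulrA _ (Y ^+ i)) -exprD -mulmxE mxtrace_mulC !mulmxA.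
rewrite -mulmxA mxtrace_mulC !mulmxA.
by congr (\tr (_ * _ ^+ _)); rewrite -addnn; lia.
Qed.

(** The numbers b_m = tr (X Y^m X Y^{2h-m}) are Frobenius inner products
    <U_i, U_j> with i + j = m, where U_i = Y^i X Y^{h-i}.  Hence
    2 b_{i+j} <= b_{2i} + b_{2j}, so that the even-indexed b_m form a convex
    sequence with equal endpoint values, and each odd-indexed b_m is at most the
    mean of its neighbours. *)
Lemma trace_alternating_le h m : (m <= h.*2)%N ->
  \tr (X * Y ^+ m * X * Y ^+ (h.*2 - m)) <= \tr (X * X * Y ^+ h.*2).
Proof.
move=> mh.
pose b i := \tr (X * Y ^+ i * X * Y ^+ (h.*2 - i)).
have bmid i j : (i <= h)%N -> (j <= h)%N -> 2 * b (i + j)%N <= b i.*2 + b j.*2.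
  move=> ih jh; have := frobenius_dot_AMGM (U h i) (U h j).
  by rewrite !dotU// !addnn.
have b0 : b 0%N = \tr (X * X * Y ^+ h.*2) by rewrite /b expr0 mulr1 subn0.
have even i : (i <= h)%N -> b i.*2 <= b 0%N.
  apply: (@convex_seq_le _ (fun i => b i.*2)) => [j jh|].
    have -> : j.+1.*2 = (j + j.+2)%N by rewrite -addnn; lia.
    by apply: bmid => //; lia.
  rewrite b0 /b subnn expr0 mulr1 -mulmxE mxtrace_mulC mulmxE.
  by rewrite mulrA.
rewrite -b0 -/(b m) -(odd_double_half m); case: (boolP (odd m)) => om /=.
  have mh2 : (m./2.+1 <= h)%N.
    by have := odd_double_half m; rewrite om -addnn -addnn in mh *; lia.
  rewrite add1n; have := bmid m./2 m./2.+1 (ltnW mh2) mh2.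
  have := even _ (ltnW mh2); have := even _ mh2.
  by rewrite addnS addnn; move: (b _) (b _) (b _) (b _) => *; lra.
by rewrite add0n; apply: even; have := half_leq mh; rewrite doubleK.
Qed.

Lemma trace_even_power h : \tr (Y ^+ h.*2) = '[Y ^+ h].
Proof. by rewrite /frobenius_dot trmxX Ysym mulmxE -exprD addnn. Qed.

Lemma trace_alternating_op_le h m L : op_le X L -> (m <= h.*2)%N ->
  \tr (X * Y ^+ m * X * Y ^+ (h.*2 - m)) <= L ^+ 2 * \tr (Y ^+ h.*2).
Proof.
move=> XL mh; rewrite (le_trans (trace_alternating_le mh))// trace_even_power.
have -> : \tr (X * X * Y ^+ h.*2) = '[X *m Y ^+ h].
  rewrite /frobenius_dot trmx_mul trmxX Xsym Ysym -addnn exprD.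
  by rewrite -mulmxE !mulmxA mxtrace_mulC !mulmxA.
exact: op_le_mulmx.
Qed.
End TraceInequality.

(** * Differential inequality for traces of powers *)

Lemma deriv_sum (R : nzRingType) I (s : seq I) (P : pred I)
    (F : I -> {poly R}) :
  (\sum_(i <- s | P i) F i)^`() = \sum_(i <- s | P i) (F i)^`().
Proof. exact: raddf_sum. Qed.

Section TracePencil.
Variables (R : rcfType) (d : nat).
Implicit Types (A B : 'M[{poly R}]_d) (X Y : 'M[R]_d).

Local Notation derivmx := (map_mx (fun p : {poly R} => p^`())).

Lemma derivmxM A B : derivmx (A * B) = derivmx A * B + A * derivmx B.
Proof.
apply/matrixP => i j; rewrite !mxE -big_split /= deriv_sum.
by apply: eq_bigr => k _; rewrite derivM !mxE.
Qed.

Lemma derivmxX A n :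
  derivmx (A ^+ n.+1) = \sum_(i < n.+1) A ^+ i * derivmx A * A ^+ (n - i).
Proof.
elim: n => [|n IH]; first by rewrite big_ord1 !expr0 expr1 mul1r mulr1.
rewrite exprS derivmxM IH [RHS]big_ord_recl expr0 mul1r subn0 mulr_sumr.
congr (_ + _).
by apply: eq_bigr => i _; rewrite lift0 exprS !mulrA subSS.
Qed.

Lemma deriv_mxtrace A : (\tr A)^`() = \tr (derivmx A).
Proof. by rewrite /mxtrace deriv_sum; apply: eq_bigr => i _; rewrite mxE. Qed.

Lemma horner_mxtrace A t : (\tr A).[t] = \tr (map_mx (horner_eval t) A).
Proof.
by rewrite /mxtrace -horner_evalE raddf_sum; apply: eq_bigr => i _; rewrite mxE.
Qed.

(** Y + tX with the indeterminate in the role of t: the derivatives in t are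
    then formal, and the mean value theorem is only needed for real
    polynomials. *)
Definition pencil Y X : 'M[{poly R}]_d :=
  map_mx polyC Y + 'X *: map_mx polyC X.

Lemma horner_pencil X Y t : map_mx (horner_eval t) (pencil Y X) = Y + t *: X.
Proof.
by apply/matrixP => i j; rewrite !mxE /horner_eval !hornerE.
Qed.

Lemma derivmx_pencil X Y : derivmx (pencil Y X) = map_mx polyC X.
Proof.
apply/matrixP => i j; rewrite !mxE derivD derivM !derivC derivX.
by rewrite mulr0 mul1r addr0 add0r.
Qed.

Lemma horner_polyCmx X t : map_mx (horner_eval t) (map_mx polyC X) = X.
Proof. by apply/matrixP => i j; rewrite !mxE /horner_eval hornerC. Qed.

Lemma horner_trace_pencil X Y n t :
  (\tr (pencil Y X ^+ n)).[t] = \tr ((Y + t *: X) ^+ n).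
Proof. by rewrite horner_mxtrace rmorphXn /= horner_pencil. Qed.

(** Cyclicity of the trace makes all the terms of the product rule equal. *)
Lemma deriv_trace_pencil X Y n :
  (\tr (pencil Y X ^+ n.+1))^`() =
  n.+1%:R * \tr (map_mx polyC X * pencil Y X ^+ n).
Proof.
rewrite deriv_mxtrace derivmxX derivmx_pencil raddf_sum /=.
rewrite (eq_bigr (fun=> \tr (map_mx polyC X * pencil Y X ^+ n))) => [|i _].
  by rewrite sumr_const card_ord mulr_natl.
rewrite -mulrA -mulmxE mxtrace_mulC mulmxE -mulrA -exprD.
by rewrite subnK // -ltnS.
Qed.

Lemma horner_deriv_trace_pencil X Y n t :
  ((\tr (pencil Y X ^+ n.+1))^`()).[t] =
  n.+1%:R * \tr (X * (Y + t *: X) ^+ n).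
Proof.
rewrite deriv_trace_pencil -polyC_natr hornerCM horner_mxtrace rmorphM rmorphXn /=.
by rewrite horner_pencil horner_polyCmx.
Qed.

Lemma horner_deriv2_trace_pencil X Y n t :
  ((\tr (pencil Y X ^+ n.+2))^`()^`()).[t] = n.+2%:R *
  \sum_(i < n.+1) \tr (X * (Y + t *: X) ^+ i * X * (Y + t *: X) ^+ (n - i)).
Proof.
rewrite deriv_trace_pencil -polyC_natr derivM derivC mul0r add0r hornerCM.
rewrite deriv_mxtrace derivmxM horner_mxtrace; congr (_ * _).
have -> : derivmx (map_mx polyC X) = 0.
  by apply/matrixP => i j; rewrite !mxE derivC.
rewrite mul0r add0r derivmxX derivmx_pencil rmorphM rmorph_sum /=.
rewrite mulr_sumr raddf_sum /=; apply: eq_bigr => i _.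
by rewrite !rmorphM !rmorphXn /= horner_pencil horner_polyCmx !mulrA.
Qed.

(** Each of the 2q + 1 terms tr (X Z^i X Z^{2q-i}) of the second derivative,
    with Z = Y + tX, is at most L^2 tr Z^{2q}. *)
Lemma horner_deriv2_trace_pencil_le X Y q L t : X^T = X -> Y^T = Y -> op_le X L ->
  ((\tr (pencil Y X ^+ q.+1.*2))^`()^`()).[t] <=
  (q.*2.+2 * q.*2.+1)%:R * L ^+ 2 * (\tr (pencil Y X ^+ q.*2)).[t].
Proof.
move=> Xs Ys XL; rewrite doubleS horner_deriv2_trace_pencil horner_trace_pencil.
rewrite natrM -!mulrA ler_wpM2l ?ler0n// mulr_natl.
rewrite -[q.*2.+1 in leRHS]card_ord -sumr_const; apply: ler_sum => i _.
rewrite mulrA -expr2; apply: trace_alternating_op_le => //; last by rewrite -ltnS.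
by rewrite linearD linearZ /= Xs Ys.
Qed.
End TracePencil.

Lemma poly_le_of_deriv (R : rcfType) (p r : {poly R}) :
  p.[0] <= r.[0] -> (forall t, 0 <= t -> p^`().[t] <= r^`().[t]) ->
  forall t, 0 <= t -> p.[t] <= r.[t].
Proof.
move=> p0 p' t t0; rewrite -subr_ge0 -hornerN -hornerD.
rewrite (@le_trans _ _ (r - p).[0])//; first by rewrite hornerD hornerN subr_ge0.
apply: (@ler_hornerW _ 0 t) => //; rewrite ?in_itv/= ?lexx ?t0// => x.
rewrite in_itv /= => /andP[/ltW x0 _].
by rewrite derivB hornerD hornerN subr_ge0 p'.
Qed.

(** The bounding polynomials g_q solve g_{q+1}'' = L^2 g_q with the same initial
    values as the a_q and zero slope at 0, so the comparison follows by induction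
    on q from two integrations.  In generating-function terms, the sum over q of
    g_q z^{2q} is cosh (L t z) times that of the a_q(0) z^{2q}. *)
Lemma poly_second_order_comparison (R : rcfType) (a : nat -> {poly R}) (L : R) :
  (forall t, (a 0%N).[t] = (a 0%N).[0]) ->
  (forall q, (a q.+1)^`().[0] = 0) ->
  (forall q t, 0 <= t -> (a q.+1)^`()^`().[t] <= L ^+ 2 * (a q).[t]) ->
  forall q t, 0 <= t ->
  (a q).[t] <= \sum_(j < q.+1) (j.*2)`!%:R^-1 * (L * t) ^+ j.*2 * (a (q - j)%N).[0].
Proof.
move=> a0 a1 a2.
pose g q : {poly R} := \sum_(j < q.+1)
  ((j.*2)`!%:R^-1 * L ^+ j.*2 * (a (q - j)%N).[0]) *: 'X^(j.*2).
have gE q t : (g q).[t] =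
    \sum_(j < q.+1) (j.*2)`!%:R^-1 * (L * t) ^+ j.*2 * (a (q - j)%N).[0].
  rewrite horner_sum; apply: eq_bigr => j _.
  by rewrite hornerZ hornerXn exprMn; ring.
have g0 q : (g q).[0] = (a q).[0].
  rewrite gE big_ord_recl big1 => [|j _]; last by rewrite mulr0 expr0n mulr0 mul0r.
  by rewrite /= expr0 fact0 invr1 !mul1r subn0 addr0.
have g' q : (g q.+1)^`() = \sum_(j < q.+1)
    ((j.*2.+1)`!%:R^-1 * L ^+ j.+1.*2 * (a (q - j)%N).[0]) *: 'X^(j.*2.+1).
  rewrite deriv_sum big_ord_recl /= derivZ derivXn scaler0 add0r.
  apply: eq_bigr => j _; rewrite derivZ derivXn /= /bump leq0n add1n doubleS /=.
  rewrite -scalerMnr scalerMnl subSS; congr (_ *: _).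
  rewrite -[LHS]mulr_natr factS natrM invfM.
  have : (j.*2.+2)%:R != 0 :> R by rewrite pnatr_eq0.
  have : (j.*2.+1)`!%:R != 0 :> R by rewrite pnatr_eq0 -lt0n fact_gt0.
  move: ((j.*2.+1)`!%:R : R) (j.*2.+2%:R : R) => f x f0 x0; field; exact/andP.
have g'' q t : (g q.+1)^`()^`().[t] = L ^+ 2 * (g q).[t].
  rewrite g' gE deriv_sum horner_sum mulr_sumr; apply: eq_bigr => j _.
  rewrite derivZ derivXn /= -scalerMnr hornerMn -mulr_natr hornerZ hornerXn.
  rewrite factS natrM invfM.
  rewrite exprMn doubleS !exprS.
  have : (j.*2.+1)%:R != 0 :> R by rewrite pnatr_eq0.
  have : (j.*2)`!%:R != 0 :> R by rewrite pnatr_eq0 -lt0n fact_gt0.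
  move: ((j.*2)`!%:R : R) (j.*2.+1%:R : R) => f x f0 x0; field; exact/andP.
move=> q t t0; rewrite -gE; elim: q t t0 => [|q IH] t t0.
  rewrite a0 gE big_ord1 /= expr0 fact0 invr1 !mul1r subn0; exact: lexx.
apply: poly_le_of_deriv => //; first by rewrite g0.
apply: poly_le_of_deriv => [|s s0].
  rewrite a1 g' horner_sum big1 // => j _.
  by rewrite hornerZ hornerXn expr0n mulr0.
by rewrite g'' (le_trans (a2 _ _ s0))// ler_wpM2l ?sqr_ge0// IH.
Qed.

(** * Even moments of sums of independent centered matrices *)

Lemma expDn_div_fact (R : numFieldType) (x y : R) q :
  \sum_(j < q.+1) x ^+ j / j`!%:R * (y ^+ (q - j) / (q - j)`!%:R) =
  (x + y) ^+ q / q`!%:R.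
Proof.
have fact0 n : n`!%:R != 0 :> R by rewrite pnatr_eq0 -lt0n fact_gt0.
rewrite [x + y]addrC exprDn mulr_suml; apply: eq_bigr => j _.
have jq : (j <= q)%N by rewrite -ltnS.
rewrite -[_ *+ 'C(q, j)]mulr_natr -(bin_fact jq) !natrM.
have c0 : 'C(q, j)%:R != 0 :> R by rewrite pnatr_eq0 -lt0n bin_gt0.
move: (fact0 j) (fact0 (q - j)%N) c0.
move: (j`!%:R : R) ((q - j)`!%:R : R) ('C(q, j)%:R : R) => a b c a0 b0 c0.
by field; rewrite a0 b0 c0.
Qed.

Lemma double_fact_ge j : (2 ^ j * j`! <= (j.*2)`!)%N.
Proof.
elim: j => // j IH; rewrite doubleS !factS expnS.
rewrite (_ : 2 * _ * _ = j.+1.*2 * (2 ^ j * j`!))%N; last by rewrite -mul2n; lia.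
rewrite doubleS leq_mul// (leq_trans IH)// leq_pmull//.
Qed.

Lemma sum_ffun_ordS (V : nmodType) (K : finType) c (G : ('I_c.+1 -> K) -> V) :
  (forall s s', s =1 s' -> G s = G s') ->
  \sum_(s : {ffun 'I_c.+1 -> K}) G s =
  \sum_(s : {ffun 'I_c -> K}) \sum_l G (fun i => oapp s l (unlift ord0 i)).
Proof.
move=> Gext; rewrite pair_bigA /=.
rewrite (reindex_onto
  (fun u : {ffun 'I_c -> K} * K => [ffun i => oapp u.1 u.2 (unlift ord0 i)])
  (fun s : {ffun 'I_c.+1 -> K} => ([ffun i => s (lift ord0 i)], s ord0))) /=.
- rewrite (eq_bigl xpredT) => [|[s l]] /=.
    by apply: eq_bigr => u _; apply: Gext => i; rewrite ffunE.
  rewrite xpair_eqE ffunE unlift_none eqxx andbT; apply/eqP/ffunP => i.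
  by rewrite !ffunE liftK.
- move=> s _; apply/ffunP => i; rewrite ffunE.
  by case: unliftP => [j|] -> /=; rewrite ?ffunE.
Qed.

Section Moments.
Variables (R : rcfType) (d k : nat) (p : 'I_k -> R) (X : 'I_k -> 'M[R]_d) (L : R).
Hypotheses (p_ge0 : forall l, 0 <= p l) (p_sum1 : \sum_l p l = 1).
Hypotheses (Xsym : forall l, (X l)^T = X l) (X_le : forall l, op_le (X l) L).
Hypothesis X_centered : \sum_l p l *: X l = 0.

(** The division by (2q)! turns the binomial convolutions of moments into plain
    convolutions. *)
Definition even_moment (q : nat) (Y : 'M[R]_d) : R :=
  (q.*2)`!%:R^-1 * \tr (Y ^+ q.*2).

(** The function t |-> E tr (Y + tX)^{2q} / (2q)! has zero slope at 0 because X
    is centered, so that the second-order comparison applies to it. *)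
Lemma even_moment_step Y q : Y^T = Y ->
  \sum_l p l * even_moment q (Y + X l) <=
  \sum_(j < q.+1) (j.*2)`!%:R^-1 * L ^+ j.*2 * even_moment (q - j) Y.
Proof.
move=> Ysym.
pose a q : {poly R} :=
  \sum_l (p l / (q.*2)`!%:R) *: \tr (pencil Y (X l) ^+ q.*2).
have aE r t : (a r).[t] = \sum_l p l * even_moment r (Y + t *: X l).
  rewrite horner_sum; apply: eq_bigr => l _.
  by rewrite hornerZ horner_trace_pencil mulrA.
have a0 r : (a r).[0] = even_moment r Y.
  rewrite aE (eq_bigr (fun l => p l * even_moment r Y)) => [|l _].
    by rewrite -mulr_suml p_sum1 mul1r.
  by rewrite scale0r addr0.
have -> : \sum_l p l * even_moment q (Y + X l) = (a q).[1].
  by rewrite aE; apply: eq_bigr => l _; rewrite scale1r.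
rewrite [leRHS](eq_bigr (fun j : 'I_q.+1 =>
    (j.*2)`!%:R^-1 * (L * 1) ^+ j.*2 * (a (q - j)%N).[0])) => [|j _]; last first.
  by rewrite mulr1 a0.
apply: poly_second_order_comparison => // [t|r|r t t0].
- rewrite a0 aE /even_moment; under eq_bigr do rewrite expr0.
  by rewrite -mulr_suml p_sum1 mul1r expr0.
- rewrite deriv_sum horner_sum (eq_bigr (fun l =>
    r.+1.*2%:R / (r.+1.*2)`!%:R * \tr ((p l *: X l) *m Y ^+ r.*2.+1))) => [|l _].
    by rewrite -mulr_sumr -raddf_sum -mulmx_suml X_centered mul0mx /= mxtrace0 mulr0.
  rewrite derivZ hornerZ doubleS horner_deriv_trace_pencil scale0r addr0.
  by rewrite -scalemxAl mxtraceZ mulmxE; ring.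
- rewrite aE deriv_sum deriv_sum horner_sum mulr_sumr; apply: ler_sum => l _.
  rewrite !derivZ hornerZ -[leLHS]mulrA [leRHS]mulrCA ler_wpM2l//.
  have := horner_deriv2_trace_pencil_le r t (Xsym l) Ysym (@X_le l).
  rewrite horner_trace_pencil.
  have f0 : 0 <= (r.+1.*2)`!%:R^-1 :> R by rewrite invr_ge0 ler0n.
  move=> /(ler_wpM2l f0) H; rewrite (le_trans H)// /even_moment.
  rewrite doubleS !factS mulnA natrM invfM.
  have : (r.*2.+2 * r.*2.+1)%:R != 0 :> R by rewrite pnatr_eq0.
  have : (r.*2)`!%:R != 0 :> R by rewrite pnatr_eq0 -lt0n fact_gt0.
  move: ((r.*2)`!%:R : R) ((r.*2.+2 * r.*2.+1)%:R : R) => f N f_neq0 N_neq0.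
  by rewrite le_eqVlt; apply/orP; left; apply/eqP; field; exact/andP.
Qed.

(** The right-hand side is d times the 2q-th moment, divided by (2q)!, of a
    centered Gaussian variable of variance c L^2.  Gaussian moments are used
    because they convolve exactly, by the binomial theorem. *)
Lemma even_moment_sum_le c q :
  \sum_(s : {ffun 'I_c -> 'I_k})
     (\prod_i p (s i)) * even_moment q (\sum_i X (s i)) <=
  d%:R * ((c%:R * (L ^+ 2 / 2)) ^+ q / q`!%:R).
Proof.
elim: c q => [|c IH] q.
  rewrite (eq_bigr (fun=> even_moment q 0)) => [|s _]; last first.
    by rewrite !big_ord0 mul1r.
  rewrite sumr_const card_ffun !card_ord expn0 mulr1n mul0r /even_moment.
  case: q => [|q]; first by rewrite !expr0 mxtrace1 !fact0 invr1 mul1r !mulr1.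
  by rewrite doubleS !exprS !mul0r mxtrace0 !mulr0.
rewrite (@sum_ffun_ordS _ _ _ (fun s =>
  (\prod_i p (s i)) * even_moment q (\sum_i X (s i)))); last first.
  move=> s s' ss'; congr (_ * even_moment _ _).
    by apply: eq_bigr => i _; rewrite ss'.
  by apply: eq_bigr => i _; rewrite ss'.
apply: (@le_trans _ _ (\sum_(s : {ffun 'I_c -> 'I_k}) (\prod_i p (s i)) *
   \sum_(j < q.+1) (j.*2)`!%:R^-1 * L ^+ j.*2 *
     even_moment (q - j) (\sum_i X (s i)))).
  apply: ler_sum => s _.
  have -> : \sum_l \prod_i p (oapp s l (unlift ord0 i)) *
      even_moment q (\sum_i X (oapp s l (unlift ord0 i))) =
    (\prod_i p (s i)) * \sum_l p l * even_moment q (\sum_i X (s i) + X l).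
    rewrite mulr_sumr; apply: eq_bigr => l _.
    rewrite !big_ord_recl unlift_none /= [X l + _]addrC [RHS]mulrCA [RHS]mulrA.
    congr (_ * even_moment _ (_ + _)).
      by congr (_ * _); apply: eq_bigr => i _; rewrite liftK.
    by apply: eq_bigr => i _; rewrite liftK.
  rewrite ler_wpM2l ?prodr_ge0// even_moment_step// [LHS]raddf_sum.
  by apply: eq_bigr => i _; exact: Xsym.
under eq_bigr do rewrite mulr_sumr.
rewrite exchange_big /= -natr1 mulrDl mul1r addrC -expDn_div_fact mulr_sumr.
apply: ler_sum => j _.
under eq_bigr do rewrite mulrCA.
rewrite -mulr_sumr [leRHS]mulrCA.
have Lj0 : 0 <= L ^+ j.*2 by rewrite -mul2n exprM exprn_ge0 ?sqr_ge0.
apply: (le_trans (ler_wpM2l _ (IH (q - j)%N))).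
  by rewrite mulr_ge0 ?invr_ge0 ?ler0n.
apply: ler_wpM2r.
  by rewrite mulr_ge0 ?ler0n// divr_ge0 ?ler0n// exprn_ge0// mulr_ge0 ?ler0n//
     divr_ge0 ?sqr_ge0.
rewrite exprMn -exprM mul2n -mulrA exprVn -invfM -natrX -natrM.
rewrite [leLHS]mulrC ler_wpM2l// lef_pV2 ?posrE ?ltr0n ?muln_gt0 ?expn_gt0
  ?fact_gt0//.
by rewrite ler_nat double_fact_ge.
Qed.
End Moments.

(** * Hermitian dilation and spectral norm *)

Section Dilation.
Variable R : rcfType.

(** The Hermitian dilation: its nonzero eigenvalues are the singular values of
    Z and their opposites. *)
Definition dilation m n (Z : 'M[R]_(m, n)) : 'M[R]_(m + n) :=
  block_mx 0 Z Z^T 0.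

Lemma dilation_sym m n (Z : 'M[R]_(m, n)) : (dilation Z)^T = dilation Z.
Proof. by rewrite /dilation tr_block_mx trmxK !trmx0. Qed.

Lemma dilation_is_linear m n : linear (@dilation m n).
Proof.
move=> a Z W; rewrite /dilation scale_block_mx add_block_mx.
by rewrite linearD linearZ /= !scaler0 !addr0.
Qed.

HB.instance Definition _ m n :=
  GRing.isLinear.Build R 'M[R]_(m, n) 'M[R]_(m + n) *:%R (@dilation m n)
    (@dilation_is_linear m n).

Lemma op_le_dilation m n (Z : 'M[R]_(m, n)) L :
  op_le Z L -> op_le (dilation Z) L.
Proof.
move=> ZL x; rewrite -[x]vsubmxK mul_block_col !mul0mx add0r addr0.
rewrite !frobenius_dot_col_mx addrC mulrDr lerD//.
exact: op_le_tr.
Qed.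

(** By Cauchy-Schwarz the ratios |H^{k+1} x|^2 / |H^k x|^2 increase with k. *)
Lemma sym_power_growth d (H : 'M[R]_d) (x : 'cV[R]_d) a : H^T = H -> 0 < a ->
  0 < '[x] -> a * '[x] <= '[H *m x] ->
  forall k, a ^+ k * '[x] <= '[H ^+ k *m x].
Proof.
move=> Hs a0 x0 ax.
have growth k : 0 < '[H ^+ k *m x] /\ a * '[H ^+ k *m x] <= '[H ^+ k.+1 *m x].
  elim: k => [|k [hk0 hk1]]; first by rewrite expr0 expr1 mul1mx.
  have := frobenius_CauchySchwarz (H ^+ k *m x) (H ^+ k.+2 *m x).
  have -> : '[H ^+ k *m x, H ^+ k.+2 *m x] = '[H ^+ k.+1 *m x].
    have E : H ^+ k *m (H ^+ k.+2 *m x) = H ^+ k.+1 *m (H ^+ k.+1 *m x).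
      by rewrite (mulmxA (H ^+ k)) (mulmxA (H ^+ k.+1)) !mulmxE -!exprD addSnnS.
    rewrite /frobenius_dot !(trmx_mul _ x) !trmxX Hs.
    by rewrite -(mulmxA x^T) E (mulmxA x^T).
  move: hk0 hk1; move: ('[_ ^+ k *m _]) ('[_ ^+ k.+1 *m _]) ('[_ ^+ k.+2 *m _]).
  move=> u v w u0 uv vw; have v0 : 0 < v by rewrite (lt_le_trans _ uv)// mulr_gt0.
  split=> //; rewrite -(ler_pM2l u0) (le_trans _ vw)// expr2 mulrCA mulrA.
  by rewrite ler_wpM2r// ltW.
elim=> [|k IH]; first by rewrite !expr0 mul1r mul1mx.
by rewrite exprS -mulrA (le_trans _ (growth k).2)// ler_wpM2l// ltW.
Qed.

(** If |Z v| > eps |v|, then (0, v) and its image (Z v, 0) under the dilation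
    are orthogonal, and the q-th power of the dilation stretches each by at least
    eps^q.  This is how the dilation yields a factor 2, reflecting
    that its spectrum is symmetric about 0. *)
Lemma dilation_even_power_ge m n (Z : 'M[R]_(m, n)) (v : 'cV[R]_n) eps q :
  0 < eps -> '[v] <= 1 -> eps ^+ 2 < '[Z *m v] ->
  2 * eps ^+ q.*2 <= \tr (dilation Z ^+ q.*2).
Proof.
move=> eps0 v1 vZ; set H := dilation Z; have Hs : H^T = H by exact: dilation_sym.
have e0 : 0 < eps ^+ 2 by rewrite exprn_gt0.
have Zv0 : 0 < '[Z *m v] by exact: lt_trans vZ.
have v0 : 0 < '[v].
  rewrite lt_neqAle frobenius_sq_ge0 andbT eq_sym frobenius_sq_eq0.
  apply: contraTneq Zv0 => ->; rewrite -leNgt.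
  by rewrite /frobenius_dot !mulmx0 mxtrace0.
pose x : 'cV[R]_(m + n) := col_mx 0 v.
pose y : 'cV[R]_(m + n) := col_mx (Z *m v) 0.
have Hx : H *m x = y by rewrite mul_block_col !mul0mx mulmx0 !addr0 add0r.
have xE : '[x] = '[v].
  by rewrite frobenius_dot_col_mx {1}/frobenius_dot mulmx0 mxtrace0 add0r.
have yE : '[y] = '[Z *m v].
  by rewrite frobenius_dot_col_mx [X in _ + X]/frobenius_dot mulmx0 mxtrace0 addr0.
have xy : eps ^+ 2 * '[x] <= '[H *m x].
  by rewrite Hx xE yE (le_trans _ (ltW vZ))// ler_piMr// ltW.
have yHy : eps ^+ 2 * '[y] <= '[H *m y].
  have := frobenius_CauchySchwarz x (H *m y).
  have -> : '[x, H *m y] = '[y].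
    by rewrite -Hx /frobenius_dot trmx_mul Hs mulmxA.
  rewrite Hx in xy; move: xy; rewrite xE yE.
  move: Zv0 v0; move: ('[Z *m v]) ('[v]) ('[H *m y]) => z w u z0 w0 zw zwu.
  rewrite -(ler_pM2l w0) (le_trans _ zwu)// mulrA [w * _]mulrC expr2 ler_wpM2r//.
  exact: ltW.
have gx := sym_power_growth Hs e0 _ xy q.
have gy := sym_power_growth Hs e0 _ yHy q.
rewrite trace_even_power//.
rewrite -mul2n exprM.
set W := H ^+ q.
have HW : W = row_mx (lsubmx W) (rsubmx W) by rewrite hsubmxK.
have Wx : W *m x = rsubmx W *m v.
  by rewrite HW mul_row_col mulmx0 add0r row_mxKr.
have Wy : W *m y = lsubmx W *m (Z *m v).
  by rewrite HW mul_row_col mulmx0 addr0 row_mxKl.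
have WE : '[W] = '[lsubmx W] + '[rsubmx W].
  by rewrite -frobenius_dot_row_mx hsubmxK.
rewrite WE mulr_natl mulr2n lerD//.
- rewrite -(ler_pM2r Zv0) (le_trans _ (frobenius_sq_mul_le _ _))//.
  by rewrite -Wy -yE gy// yE.
- rewrite -(ler_pM2r v0) (le_trans _ (frobenius_sq_mul_le _ _))//.
  by rewrite -Wx -xE gx// xE.
Qed.
End Dilation.

Section SpectralNorm.
Variable R : realType.

Lemma frobenius_normE m n (A : 'M[R]_(m, n)) : frobenius_norm A ^+ 2 = '[A].
Proof.
rewrite sqr_sqrtr ?frobenius_dotE//.
by do 2!(apply: sumr_ge0 => ? _); exact: sqr_ge0.
Qed.

Lemma euclidean_normE n (x : 'cV[R]_n) : euclidean_norm x = Num.sqrt '[x].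
Proof.
rewrite /euclidean_norm frobenius_dotE; congr Num.sqrt.
by apply: eq_bigr => i _; rewrite big_ord1.
Qed.

Let image_unit_ball m n (A : 'M[R]_(m, n)) :=
  [set euclidean_norm (A *m x) | x in [set x | euclidean_norm x <= 1]].

Lemma unit_ballE n (x : 'cV[R]_n) : (euclidean_norm x <= 1) = ('[x] <= 1).
Proof.
by rewrite euclidean_normE -{1}[1]sqrtr1 ler_psqrt ?nnegrE ?frobenius_sq_ge0.
Qed.

Lemma image_unit_ball_ubound m n (A : 'M[R]_(m, n)) :
  has_ubound (image_unit_ball A).
Proof.
exists (Num.sqrt '[A]) => _ [x /= x1 <-].
rewrite euclidean_normE ler_sqrt ?frobenius_sq_ge0//.
rewrite (le_trans (frobenius_sq_mul_le _ _))// ler_piMr ?frobenius_sq_ge0//.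
by rewrite -unit_ballE.
Qed.

Lemma image_unit_ball0 m n (A : 'M[R]_(m, n)) : image_unit_ball A 0.
Proof.
exists 0; first by rewrite /= unit_ballE /frobenius_dot mulmx0 mxtrace0.
by rewrite mulmx0 euclidean_normE /frobenius_dot mulmx0 mxtrace0 sqrtr0.
Qed.

Lemma spectral_norm_ge0 m n (A : 'M[R]_(m, n)) : 0 <= spectral_norm A.
Proof. exact: (ub_le_sup (image_unit_ball_ubound A) (image_unit_ball0 A)). Qed.

Lemma op_le_spectral_norm m n (A : 'M[R]_(m, n)) : op_le A (spectral_norm A).
Proof.
move=> x; have [->|x0] := eqVneq x 0.
  by rewrite /frobenius_dot !mulmx0 mxtrace0 mulr0.
have xgt0 : 0 < '[x].
  by rewrite lt_neqAle frobenius_sq_ge0 eq_sym frobenius_sq_eq0 x0.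
pose y := (Num.sqrt '[x])^-1 *: x.
have yE : '[y] = 1.
  by rewrite frobenius_sqZ exprVn (sqr_sqrtr (ltW xgt0)) mulVf// gt_eqF.
have : euclidean_norm (A *m y) <= spectral_norm A.
  apply: (ub_le_sup (image_unit_ball_ubound A)); exists y => //=.
  by rewrite unit_ballE yE.
rewrite euclidean_normE -scalemxAr -(ler_pXn2r (_ : 0 < 2)%N) ?nnegrE
  ?sqrtr_ge0 ?spectral_norm_ge0//.
rewrite sqr_sqrtr ?frobenius_sq_ge0// frobenius_sqZ exprVn (sqr_sqrtr (ltW xgt0)).
by rewrite ler_pdivrMl// [_ * '[x]]mulrC.
Qed.

Lemma spectral_norm_gtP m n (A : 'M[R]_(m, n)) eps : 0 <= eps ->
  eps < spectral_norm A -> exists2 v : 'cV[R]_n, '[v] <= 1 & eps ^+ 2 < '[A *m v].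
Proof.
move=> eps0 epsA.
have [_ [v /= v1 <-] vA] := sup_gt (ex_intro _ 0 (image_unit_ball0 A)) epsA.
exists v; first by rewrite -unit_ballE.
rewrite euclidean_normE in vA.
rewrite -[ltRHS]sqr_sqrtr ?frobenius_sq_ge0//.
by rewrite ltr_pXn2r// nnegrE sqrtr_ge0.
Qed.
End SpectralNorm.

(** * Tail bound and sampling *)

(** Summing the hypothesis over q gives a cosh x <= b exp y, and
    cosh x >= exp x / 2. *)
Lemma expR_le_of_even_coeff (R : realType) (a b x y : R) :
  0 <= a -> 0 <= b -> 0 <= x -> 0 <= y ->
  (forall q, a * (x ^+ q.*2 / (q.*2)`!%:R) <= b * (y ^+ q / q`!%:R)) ->
  a * expR x <= 2 * b * expR y.
Proof.
move=> a0 b0 x0 y0 H.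
pose u N := a * (series (exp_coeff x) N + series (exp_coeff (- x)) N).
have term i : exp_coeff x i + exp_coeff (- x) i =
    if odd i then 0 else 2 * (x ^+ i / i`!%:R).
  rewrite /exp_coeff /= exprNn -signr_odd.
  by case: (odd i); rewrite ?expr1 ?expr0; ring.
have term_ge0 i : 0 <= exp_coeff x i + exp_coeff (- x) i.
  by rewrite term; case: odd => //; rewrite mulr_ge0// divr_ge0// exprn_ge0.
have uE N : u N = a * \sum_(0 <= i < N) (exp_coeff x i + exp_coeff (- x) i).
  by rewrite /u /series /= big_split.
have u_double N : u N.*2 = 2 * \sum_(0 <= q < N) a * (x ^+ q.*2 / (q.*2)`!%:R).
  elim: N => [|N IH]; first by rewrite uE !big_geq// !mulr0.
  rewrite big_nat_recr//= mulrDr -IH !uE doubleS !big_nat_recr//= !term /=.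
  by rewrite odd_double /=; ring.
have u_le N : u N <= 2 * b * expR y.
  (* the even partial sums suffice because the terms are nonnegative *)
  rewrite (@le_trans _ _ (u N.*2))//.
    rewrite !uE ler_wpM2l// (@big_cat_nat _ _ _ N 0 N.*2)//=; last first.
      by rewrite -addnn leq_addr.
    by rewrite lerDl sumr_ge0.
  rewrite u_double -mulrA ler_wpM2l//.
  rewrite (@le_trans _ _ (b * series (exp_coeff y) N))//.
    by rewrite /series /= mulr_sumr ler_sum.
  rewrite ler_wpM2l//; apply: nondecreasing_cvgn_le.
    by apply: nondecreasing_series => i _ _; exact: exp_coeff_ge0.
  exact: is_cvg_series_exp_coeff.
have u_cvg : u @ \oo --> a * (expR x + expR (- x)).
  apply: cvgMl_tmp; apply: cvgD; exact: is_cvg_series_exp_coeff.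
rewrite (@le_trans _ _ (a * (expR x + expR (- x))))//.
  by rewrite ler_wpM2l// lerDl ltW// expR_gt0.
rewrite -(cvg_lim _ u_cvg)//; apply: limr_le; first exact: cvgP u_cvg.
by apply: nearW.
Qed.

(** Markov's inequality applied to the trace of each even power of the dilated
    sum gives one bound per q, and expR_le_of_even_coeff combines them.  The
    product measure on samples is written out as a finite sum. *)
Lemma matrix_Hoeffding (R : realType) m n k c (p : 'I_k -> R)
    (X : 'I_k -> 'M[R]_(m, n)) (K eps : R) :
  (forall l, 0 <= p l) -> \sum_l p l = 1 -> \sum_l p l *: X l = 0 ->
  (forall l, op_le (X l) K) -> 0 < K -> 0 < eps -> (0 < c)%N ->
  \sum_(s : {ffun 'I_c -> 'I_k}
         | eps < spectral_norm (c%:R^-1 *: \sum_i X (s i))) \prod_i p (s i)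
  <= (m + n)%:R * expR (- (c%:R * eps ^+ 2 / (2 * K ^+ 2))).
Proof.
move=> p0 p1 pX XK K0 eps0 c0.
have cR0 : 0 < c%:R :> R by rewrite ltr0n.
set W := \sum_(s | _) _.
have W0 : 0 <= W by apply: sumr_ge0 => s _; exact: prodr_ge0.
pose ceps := c%:R * eps.
have ceps0 : 0 < ceps by exact: mulr_gt0.
have moment q : W * (2 * ceps ^+ q.*2) / (q.*2)`!%:R <=
    (m + n)%:R * ((c%:R * (K ^+ 2 / 2)) ^+ q / q`!%:R).
  apply: le_trans (@even_moment_sum_le _ _ _ p (fun l => dilation (X l)) K
    p0 p1 (fun l => dilation_sym (X l)) (fun l => op_le_dilation (XK l)) _ c q).
    rewrite [leLHS]mulrAC -mulrA mulr_suml big_mkcond /=; apply: ler_sum => s _.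
    rewrite -raddf_sum /even_moment; case: ifPn => [bad|_]; last first.
      rewrite mulr_ge0 ?prodr_ge0// mulr_ge0 ?invr_ge0//.
      by rewrite trace_even_power ?dilation_sym// frobenius_sq_ge0.
    rewrite ler_wpM2l ?prodr_ge0// ler_wpM2l ?invr_ge0//.
    have [v v1] := spectral_norm_gtP (ltW eps0) bad.
    rewrite -scalemxAl frobenius_sqZ exprVn ltr_pdivlMl ?exprn_gt0// -exprMn.
    exact: dilation_even_power_ge.
  transitivity (dilation (\sum_l p l *: X l)); last by rewrite pX raddf0.
  by rewrite [RHS]raddf_sum; apply: eq_bigr => l _; exact/esym/linearZ.
pose x := c%:R * eps ^+ 2 / K ^+ 2.
have x0 : 0 <= x by rewrite divr_ge0 ?mulr_ge0 ?sqr_ge0// ltW.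
have : W * 2 * expR x <= 2 * (m + n)%:R * expR (x / 2).
  have x20 : 0 <= x / 2 by rewrite divr_ge0.
  have W20 : 0 <= W * 2 by rewrite mulr_ge0.
  apply: expR_le_of_even_coeff => // q.
  (* theta minimises c K^2 theta^2 / 2 - c eps theta *)
  pose theta := eps / K ^+ 2.
  have : 0 <= theta ^+ q.*2.
    by rewrite exprn_ge0// divr_ge0 ?sqr_ge0// ltW.
  move=> /ler_wpM2l/(_ _ _ (moment q)); congr (_ <= _).
    have -> : x = theta * ceps by rewrite /theta /ceps /x; ring.
    by rewrite [(theta * ceps) ^+ _]exprMn; ring.
  have -> : x / 2 = theta ^+ 2 * (c%:R * (K ^+ 2 / 2)).
    by rewrite /theta /x; field; rewrite gt_eqF.
  by rewrite [(theta ^+ 2 * _) ^+ _]exprMn -exprM mul2n; ring.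
have -> : - (c%:R * eps ^+ 2 / (2 * K ^+ 2)) = x / 2 - x.
  by rewrite /x; field; rewrite gt_eqF.
rewrite expRD expRN mulrA ler_pdivlMr ?expR_gt0//; lra.
Qed.

(** The event is a finite disjoint union of cylinders [r = s], whose
    probabilities factor by independence. *)
Lemma iid_samples_event (d : measure_display) (T : measurableType d)
    (R : realType) (P : probability T R) k c (p : 'I_k -> R)
    (r : 'I_c -> T -> 'I_k) (bad : pred ('I_c -> 'I_k)) :
  iid_samples P p r ->
  P [set w | bad (r^~ w)] =
  (\sum_(s : {ffun 'I_c -> 'I_k} | bad s) \prod_i p (s i))%:E.
Proof.
move=> [r_meas r_dist r_indep].
pose cyl (s : {ffun 'I_c -> 'I_k}) : set T :=
  \bigcap_(i in [set` [set: 'I_c]%SET]) (r i @^-1` [set s i]).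
have cylE s w : cyl s w <-> s = [ffun i => r i w].
  split=> [sw|-> i _]; last by rewrite /= ffunE.
  by apply/ffunP => i; rewrite ffunE; apply/esym/sw; rewrite /= finset.in_setT.
have -> : [set w | bad (r^~ w)] =
    \bigcup_(s in [set` [pred s | bad (fun_of_fin s)]]) cyl s.
  apply/seteqP; split=> w /=.
    move=> badw; exists [ffun i => r i w]; last exact/cylE.
    rewrite /= inE; have -> // : fun_of_fin [ffun i => r i w] = r^~ w.
    by apply/funext => i; rewrite ffunE.
  move=> [s /= bads /cylE sE]; move: bads; rewrite inE sE.
  by have -> // : fun_of_fin [ffun i => r i w] = r^~ w
    by apply/funext => i; rewrite ffunE.
rewrite measure_fin_bigcup; last 3 first.
- exact: finite_finset.
- by move=> s s' _ _ [w [/cylE -> /cylE ->]].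
- by move=> s _; apply: fin_bigcap_measurable => // i _; exact: r_meas.
rewrite -(bigfs _ (index_enum_uniq {ffun 'I_c -> 'I_k})); last first.
  by move=> s _; rewrite mem_index_enum.
rewrite -sumEFin; apply: eq_bigr => s _.
rewrite [LHS](r_indep _ (fun i => [set s i])).
rewrite (eq_bigr (fun i => (p (s i))%:E)) => [|i _]; last exact: r_dist.
by rewrite prodEFin; congr EFin; apply: eq_bigl => i; rewrite finset.in_setT.
Qed.

Lemma sum_block_product (R : realType) m n rho k (A : 'M[R]_(m, n))
    (B : 'M[R]_(n, rho)) (Theta : 'I_k -> {set 'I_n}) :
  enumerates_partition Theta -> \sum_l block_product A B Theta l = A *m B.
Proof.
case=> Theta_inj Theta_part; apply/matrixP => i j; rewrite summxE mxE.
transitivity (\sum_(h in [set: 'I_n]%SET) A i h * B h j); last first.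
  by apply: eq_bigl => h; rewrite finset.in_setT.
rewrite (set_partition_big _ Theta_part) /= big_imset; last first.
  by move=> l l' _ _; exact: Theta_inj.
apply: eq_bigr => l _; rewrite mxE (big_enum_val (fun x => A i x * B x j)) /=.
by apply: eq_bigr => h _; rewrite !mxE.
Qed.

Theorem corollary2p7 (R : realType) (m n rho k c : nat)
    (A : 'M[R]_(m, n)) (B : 'M[R]_(n, rho))
    (Theta : 'I_k -> {set 'I_n})
    (hTheta : enumerates_partition Theta)
    (hAB : forall l : 'I_k, block_product A B Theta l <> 0)
    (hc : (1 <= c)%N)
    (d : measure_display) (T : measurableType d) (P : probability T R)
    (r : 'I_c -> T -> 'I_k)
    (hr : iid_samples P (optimal_prob A B Theta) r)
    (eps : R) (heps : 0 < eps) :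
  let M := total_mass A B Theta in
  let L := spectral_norm (A *m B) + M in
  let Shat (w : T) :=
    sampled_product A B Theta (optimal_prob A B Theta) (r^~ w) in
  (P [set w | (eps < spectral_norm (Shat w - A *m B))%R] <=
   ((m + rho)%:R *
    expR (- (c%:R * eps ^+ 2 / (2 * L ^+ 2 + eps * L))))%:E)%E.
Proof.
cbv beta zeta; set M := total_mass A B Theta; set K := spectral_norm _ + M.
set p := optimal_prob A B Theta in hr *.
have sigma_gt0 l : 0 < frobenius_norm (block_product A B Theta l).
  rewrite lt_neqAle sqrtr_ge0 andbT eq_sym -sqrf_eq0 frobenius_normE.
  by rewrite frobenius_sq_eq0; apply/eqP.
have [k0|k0] := posnP k.
  (* no sample point exists, although the space has mass 1 *)
  have T0 : [set: T] = set0.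
    apply/seteqP; split=> // w _.
    by move: (r (Ordinal hc) w); rewrite k0 => -[].
  by have := @probability_setT _ _ _ P; rewrite T0 measure0 => /esym/eqP;
     rewrite onee_eq0.
have M0 : 0 < M.
  rewrite /M /total_mass (bigD1 (Ordinal k0))//= ltr_pwDl//.
  by apply: sumr_ge0 => l _; exact: sqrtr_ge0.
have p_gt0 l : 0 < p l by exact: divr_gt0.
have p_sum1 : \sum_l p l = 1.
  by rewrite /p /optimal_prob -mulr_suml divff// gt_eqF.
have K0 : 0 < K by rewrite ltr_wpDl// spectral_norm_ge0.
pose X l := (p l)^-1 *: block_product A B Theta l + - (A *m B).
have X_centered : \sum_l p l *: X l = 0.
  under eq_bigr do rewrite scalerDr scalerA mulfV ?gt_eqF// scale1r.
  by rewrite big_split /= sum_block_product// -scaler_suml p_sum1 scale1r subrr.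
have X_le l : op_le (X l) K.
  rewrite /K addrC; apply: op_leD; rewrite ?(ltW M0) ?spectral_norm_ge0//.
    move=> x; rewrite (le_trans (frobenius_sq_mul_le _ _))//.
    rewrite frobenius_sqZ -frobenius_normE ler_wpM2r ?frobenius_sq_ge0//.
    rewrite le_eqVlt -exprMn; apply/orP; left; apply/eqP; congr (_ ^+ 2).
    by rewrite /p /optimal_prob -/M; field; rewrite !gt_eqF.
  move=> x; rewrite mulNmx -scaleN1r frobenius_sqZ sqrrN expr1n mul1r.
  exact: op_le_spectral_norm.
have ShatE (s : 'I_c -> 'I_k) :
    sampled_product A B Theta p s - A *m B = c%:R^-1 *: \sum_i X (s i).
  rewrite /sampled_product big_split /= sumr_const card_ord scalerDr.
  congr (_ + _); rewrite -[- (A *m B) *+ c]scaler_nat scalerA mulVf ?scale1r//.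
  by rewrite pnatr_eq0 -lt0n.
have -> : [set w |
    eps < spectral_norm (sampled_product A B Theta p (r^~ w) - A *m B)] =
    [set w | [pred s | eps < spectral_norm (c%:R^-1 *: \sum_i X (s i))] (r^~ w)].
  by apply/seteqP; split=> w; rewrite /= -ShatE.
rewrite (iid_samples_event _ hr) lee_fin.
have := matrix_Hoeffding (fun l => ltW (p_gt0 l)) p_sum1 X_centered X_le K0 heps hc.
move/le_trans; apply; rewrite ler_wpM2l// ler_expR lerN2 ler_wpM2l//.
  by rewrite mulr_ge0 ?sqr_ge0.
have K2 : 0 < 2 * K ^+ 2 by rewrite mulr_gt0// exprn_gt0.
by rewrite lef_pV2 ?posrE ?addr_gt0 ?lerDl ?(mulr_gt0 heps K0)// ltW// mulr_gt0.
Qed.
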